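(* Let $L=\mathfrak{sl}_2(\mathbb{F}_q)$ with $q$ odd. Let $\mathcal{L}$ be the set of lines (one-dimensional subalgebras) of $L$ and $\mathcal{B}$ the set of Borel subalgebras of $L$. Then, in the comaximal graph $\Gamma(L)$: (1) If $A,B\in\mathcal{B}$ with $A\neq B$, then $A\sim B$. Hence the induced subgraph on $\mathcal{B}$ is the complete graph $K_{q+1}$. (2) If $A\in\mathcal{L}$ and $B\in\mathcal{B}$, then $A\sim B$ if and only if $A\not\subseteq B$. (3) If $A_1,A_2\in\mathcal{L}$ with $A_1\neq A_2$, then $A_1\sim A_2$ if and only if there is no $B\in\mathcal{B}$ such that $A_1,A_2\subseteq B$.
   Context: The comaximal graph $\Gamma(L)$ of a finite-dimensional Lie algebra $L$ is the simple undirected graph whose vertices are the nonzero proper Lie subalgebras of $L$, two distinct vertices $A,B$ being adjacent (written $A\sim B$) if and only if $\langle A,B\rangle=L$, where $\langle A,B\rangle$ denotes the Lie subalgebra generated by $A\cup B$. The Borel subalgebras of $\mathfrak{sl}_2(\mathbb{F}_q)$ are its two-dimensional Lie subalgebras (equivalently, the conjugates of the subalgebra of traceless upper triangular matrices). *)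

(* Defs.v *)
From HB Require Import structures.
From mathcomp Require Import all_boot all_order all_algebra.

Set Implicit Arguments.
Unset Strict Implicit.
Unset Printing Implicit Defensive.

Import GRing.Theory.
Local Open Scope ring_scope.

HB.mixin Record isLieAlgebra (F : fieldType) L of Vector F L := {
  lie : L -> L -> L;
  lieDZl : forall (a : F) (x y z : L), lie (a *: x + y) z = a *: lie x z + lie y z;
  lieDZr : forall (a : F) (x y z : L), lie z (a *: x + y) = a *: lie z x + lie z y;
  liexx : forall x : L, lie x x = 0;
  lie_jacobi : forall x y z : L,
    lie x (lie y z) + lie y (lie z x) + lie z (lie x y) = 0
}.

#[short(type="lieType")]
HB.structure Definition LieAlgebra (F : fieldType) :=
  { L of Vector F L & isLieAlgebra F L }.

Section Subalgebras.
Variables (F : fieldType) (L : lieType F).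
Implicit Types U V W : {vspace L}.

Lemma lie_sumZl n (a : 'I_n -> F) (x : 'I_n -> L) y :
  lie (\sum_i a i *: x i) y = \sum_i a i *: lie (x i) y.
Proof.
have lie0 z : lie (0 : L) z = 0.
  by have := lieDZl (-1) z z z; rewrite !scaleN1r !addNr.
elim/big_rec2: _ => [//|i v u _ <-]; exact: lieDZl.
Qed.

Lemma lie_sumZr n (a : 'I_n -> F) (x : 'I_n -> L) y :
  lie y (\sum_i a i *: x i) = \sum_i a i *: lie y (x i).
Proof.
have lie0 z : lie z (0 : L) = 0.
  by have := lieDZr (-1) z z z; rewrite !scaleN1r !addNr.
elim/big_rec2: _ => [//|i v u _ <-]; exact: lieDZr.
Qed.

(* Independent of the bases: the span of all [u, v], u in U, v in V; see
   memv_lie and lie_prodvP. *)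
Definition lie_prodv U V : {vspace L} :=
  <<[seq lie u v | u <- vbasis U, v <- vbasis V]>>%VS.

Lemma memv_lie U V : {in U & V, forall u v, lie u v \in lie_prodv U V}.
Proof.
move=> u v /coord_vbasis-> /coord_vbasis->.
rewrite lie_sumZl; apply: memv_suml => i _.
rewrite lie_sumZr memvZ //; apply: memv_suml => j _.
rewrite memvZ // memv_span //.
by apply/allpairsP; exists ((vbasis U)`_i, (vbasis V)`_j); rewrite !memt_nth.
Qed.

Lemma lie_prodvP U V W :
  reflect {in U & V, forall u v, lie u v \in W} (lie_prodv U V <= W)%VS.
Proof.
apply: (iffP idP) => [sUVW u v Uu Vv | sUVW].
  by rewrite (subvP sUVW) // memv_lie.
apply/span_subvP=> _ /allpairsP[[u v] /= [Uu Vv ->]].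
by rewrite sUVW ?vbasis_mem.
Qed.

Definition lie_subalgebra U : bool := (lie_prodv U U <= U)%VS.

Lemma lie_subalgebraP U :
  reflect {in U &, forall x y, lie x y \in U} (lie_subalgebra U).
Proof. exact: lie_prodvP. Qed.

(* The Lie subalgebra generated by U. A non-stationary step raises the
   dimension, so \dim {:L} steps suffice; see lie_gen_subalgebra, sub_lie_gen
   and lie_gen_min. *)
Definition lie_gen U : {vspace L} :=
  iter (\dim {:L}) (fun V => V + lie_prodv V V)%VS U.

Lemma sub_lie_gen U : (U <= lie_gen U)%VS.
Proof.
rewrite /lie_gen; elim: (\dim _) => //= n IHn.
exact: subv_trans IHn (addvSl _ _).
Qed.

Lemma lie_gen_min U V : lie_subalgebra V -> (U <= V)%VS -> (lie_gen U <= V)%VS.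
Proof.
move=> /lie_subalgebraP algV sUV; rewrite /lie_gen.
elim: (\dim _) => //= n IHn; rewrite subv_add IHn.
by apply/lie_prodvP=> x y /(subvP IHn) Vx /(subvP IHn) Vy; apply: algV.
Qed.

Lemma lie_gen_subalgebra U : lie_subalgebra (lie_gen U).
Proof.
pose f V := (V + lie_prodv V V)%VS; rewrite /lie_gen -/f.
have stable V n : lie_subalgebra V -> iter n f V = V.
  by move=> algV; elim: n => //= n ->; apply/addv_idPl.
have grow n : lie_subalgebra (iter n f U) || (n <= \dim (iter n f U))%N.
  elim: n => [|n]; first by rewrite orbT.
  case: (boolP (lie_subalgebra _)) => [algV _|nalgV /= le_n].
    by rewrite /= {1}/f (addv_idPl algV) algV.
  apply/orP; right; apply: leq_ltn_trans le_n _.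
  rewrite ltn_neqAle dimvS ?addvSl // andbT.
  apply: contra nalgV => eq_dim.
  have /eqP eqf : iter n f U == f (iter n f U) by rewrite eqEdim addvSl (eqP eq_dim) leqnn.
  by rewrite /lie_subalgebra {3}eqf addvSr.
have /orP[//|dim_ge] := grow (\dim {:L}).
suff -> : iter (\dim {:L}) f U = fullv by apply: subvf.
by apply/eqP; rewrite eqEdim subvf.
Qed.

End Subalgebras.

Record sgraph := SGraph {
  vertex :> eqType;
  adj : rel vertex;
  adj_sym : symmetric adj;
  adj_irrefl : irreflexive adj
}.

Section InducedSubgraph.
Variables (G : sgraph) (P : pred G).

Definition induced_adj : rel {x : G | P x} := fun x y => adj (val x) (val y).

Fact induced_adj_sym : symmetric induced_adj.
Proof. by move=> x y; apply: adj_sym. Qed.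

Fact induced_adj_irrefl : irreflexive induced_adj.
Proof. by move=> x; apply: adj_irrefl. Qed.

Definition induced : sgraph := SGraph induced_adj_sym induced_adj_irrefl.

End InducedSubgraph.

Section CompleteGraph.
Variable n : nat.

Definition complete_adj : rel 'I_n := fun i j => i != j.

Fact complete_adj_sym : symmetric complete_adj.
Proof. by move=> i j; rewrite /complete_adj eq_sym. Qed.

Fact complete_adj_irrefl : irreflexive complete_adj.
Proof. by move=> i; rewrite /complete_adj eqxx. Qed.

Definition complete_graph : sgraph :=
  SGraph complete_adj_sym complete_adj_irrefl.

End CompleteGraph.

Definition graph_isomorphic (G H : sgraph) : Prop :=
  exists2 f : G -> H, bijective f & {mono f : x y / adj x y}.

Section ComaximalGraph.
Variables (F : fieldType) (L : lieType F).

Definition proper_subalgebra (A : {vspace L}) : bool :=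
  [&& lie_subalgebra A, A != 0%VS & A != fullv].

Definition comaximal_vertex := {A : {vspace L} | proper_subalgebra A}.

(* A subspace contains A and B iff it contains A + B, so the subalgebra
   generated by the union of A and B is lie_gen (A + B). *)
Definition comaximal_adj : rel comaximal_vertex :=
  fun A B => (A != B) && (lie_gen (val A + val B) == fullv).

Fact comaximal_adj_sym : symmetric comaximal_adj.
Proof. by move=> A B; rewrite /comaximal_adj eq_sym addvC. Qed.

Fact comaximal_adj_irrefl : irreflexive comaximal_adj.
Proof. by move=> A; rewrite /comaximal_adj eqxx. Qed.

Definition comaximal_graph : sgraph :=
  SGraph comaximal_adj_sym comaximal_adj_irrefl.

End ComaximalGraph.

Section SpecialLinear.
Variables (F : fieldType) (n : nat).

Definition traceless : {vspace 'M[F]_n} :=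
  lker (linfun (mxtrace : 'M[F]_n -> F^o)).

Lemma tracelessE (A : 'M[F]_n) : (A \in traceless) = (\tr A == 0).
Proof. by rewrite memv_ker lfunE. Qed.

Definition sl := subvs_of traceless.

HB.instance Definition _ := Vector.on sl.

Fact commutator_traceless (x y : sl) :
  val x *m val y - val y *m val x \in traceless.
Proof. by rewrite tracelessE linearB /= mxtrace_mulC subrr. Qed.

Definition sl_lie (x y : sl) : sl := Subvs (commutator_traceless x y).

Fact sl_lieDZl (a : F) (x y z : sl) :
  sl_lie (a *: x + y) z = a *: sl_lie x z + sl_lie y z.
Proof.
apply: val_inj; rewrite /= mulmxDl mulmxDr -scalemxAl -scalemxAr scalerBr.
by rewrite opprD addrACA.
Qed.

Fact sl_lieDZr (a : F) (x y z : sl) :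
  sl_lie z (a *: x + y) = a *: sl_lie z x + sl_lie z y.
Proof.
apply: val_inj; rewrite /= mulmxDl mulmxDr -scalemxAl -scalemxAr scalerBr.
by rewrite opprD addrACA.
Qed.

Fact sl_liexx (x : sl) : sl_lie x x = 0.
Proof. by apply: val_inj; rewrite /= subrr. Qed.

Fact sl_lie_jacobi (x y z : sl) :
  sl_lie x (sl_lie y z) + sl_lie y (sl_lie z x) + sl_lie z (sl_lie x y) = 0.
Proof.
apply: val_inj => /=; move: (vsval x) (vsval y) (vsval z) => {x y z} a b c.
rewrite !mulmxBl !mulmxBr !mulmxA !opprB.
rewrite (AC ((2*2)*(2*2)*(2*2)) ((1*12)*(7*2)*(3*10)*(5*4)*(11*6)*(9*8))) /=.
by rewrite !subrr !addr0.
Qed.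

HB.instance Definition _ :=
  isLieAlgebra.Build F sl sl_lieDZl sl_lieDZr sl_liexx sl_lie_jacobi.

End SpecialLinear.

Section LinesAndBorels.
Variable F : fieldType.
Implicit Type A : comaximal_graph (sl F 2).

(* Vertices are nonzero proper subalgebras by construction, so only the
   dimension has to be specified. *)
Definition is_line : pred (comaximal_graph (sl F 2)) :=
  fun A => \dim (val A) == 1%N.

Definition is_borel : pred (comaximal_graph (sl F 2)) :=
  fun A => \dim (val A) == 2%N.

Lemma dim_sl2 : \dim {:sl F 2} = 3%N.
Proof.
have dimK : (\dim {:sl F 2} = \dim (traceless F 2))%N by rewrite dimvf.
pose tr2 := linfun (mxtrace : 'M[F]_2 -> F^o).
have dim_img : \dim (limg tr2) = 1%N.
  apply/eqP; rewrite eqn_leq (leq_trans (dimvS (subvf _))) ?dimvf //=.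
  rewrite lt0n dimv_eq0; apply/negP=> /eqP img0.
  have : tr2 (delta_mx 0 0) \in limg tr2 by rewrite memv_img ?memvf.
  rewrite img0 memv0 lfunE /= /mxtrace !big_ord_recl big_ord0 !mxE /= !addr0.
  by rewrite oner_eq0.
have := limg_ker_dim tr2 fullv; rewrite capfv dim_img addn1 dimvf /= => -[].
by rewrite dimK.
Qed.

(* No one- or two-dimensional subalgebra is left out by is_line and is_borel. *)
Lemma proper_subalgebra12 (A : {vspace sl F 2}) :
  lie_subalgebra A -> \dim A \in [:: 1; 2]%N -> proper_subalgebra A.
Proof.
move=> algA dimA; rewrite /proper_subalgebra algA -dimv_eq0 /=.
apply/andP; split; first by apply: contraTneq dimA => ->.
by apply: contraTneq dimA => ->; rewrite dim_sl2.
Qed.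

End LinesAndBorels.

(* Main.v *)
(** Two distinct planes of the three-dimensional algebra [sl F 2], or a line
and a plane not containing it, already span everything, and two distinct lines
span a plane; hence all adjacency claims are matters of dimension.

The Borel subalgebras are counted through the projective line: the matrices
[[a, b], [c, -a]] having the column vector (1, t), resp. (0, 1), as an
eigenvector are those with c = 2ta + t^2 b, resp. b = 0.  Conversely, if u, v is
a basis of a Borel subalgebra U, then w = [u, v] is nonzero, lies in U and is
orthogonal to U for the trace form; so w is isotropic, i.e. nilpotent, and U is
the stabilizer of the line ker w. *)

Require Import Defs.
From HB Require Import structures.
From mathcomp Require Import all_boot all_order all_algebra.
From mathcomp Require Import fingroup cyclic ring.

Set Implicit Arguments.
Unset Strict Implicit.
Unset Printing Implicit Defensive.

Import GRing.Theory.
Local Open Scope ring_scope.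

(** * Adjacency decided by dimension counts in a three-dimensional algebra *)

Section Comaximality.
Variable F : fieldType.
Notation L := (sl F 2).
Notation G := (comaximal_graph L).
Implicit Types (U V W : {vspace L}) (A B : G).

Lemma full_sl2 U : (2 < \dim U)%N -> U = fullv.
Proof. by move=> dimU; apply/eqP; rewrite eqEdim subvf dim_sl2. Qed.

Lemma lie_gen_full U : U = fullv -> lie_gen U = fullv.
Proof. by move=> eqU; apply/eqP; rewrite eqEsubv subvf -{1}eqU sub_lie_gen. Qed.

Lemma dim_addv_gt U V : ~~ (U <= V)%VS -> (\dim V < \dim (U + V))%N.
Proof.
move=> nUV; rewrite ltn_neqAle dimvS ?addvSr // andbT.
apply: contra nUV => eq_dim.
have /eqP -> : V == (U + V)%VS by rewrite eqEdim addvSr -(eqP eq_dim) leqnn.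
exact: addvSl.
Qed.

Lemma borel_adj A B :
  is_borel B -> A != B -> ~~ (val A <= val B)%VS -> adj A B.
Proof.
move=> /eqP dimB neAB nAB; rewrite /= /comaximal_adj neAB /=.
have := dim_addv_gt nAB; rewrite dimB => /full_sl2 /lie_gen_full eqL.
exact/eqP.
Qed.

Lemma borels_adj A B : is_borel A -> is_borel B -> A != B -> adj A B.
Proof.
move=> /eqP dimA borelB neAB; apply: borel_adj => //.
by apply: contra neAB => sAB; rewrite -val_eqE eqEdim sAB dimA (eqP borelB).
Qed.

(** A Borel subalgebra is closed under the bracket, so whatever two of its subspaces generate stays
    inside it and has dimension at most 2. *)
Lemma nadj_sub_borel A1 A2 B :
  is_borel B -> (val A1 <= val B)%VS -> (val A2 <= val B)%VS -> ~~ adj A1 A2.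
Proof.
move=> /eqP dimB sA1 sA2; apply/negP => /andP[_ /eqP gen_full].
have /and3P[algB _ _] := valP B.
have /dimvS : (lie_gen (val A1 + val A2) <= val B)%VS.
  by rewrite lie_gen_min // subv_add sA1.
by rewrite gen_full dim_sl2 dimB.
Qed.

Lemma line_borel_adj A B :
  is_line A -> is_borel B -> adj A B <-> ~ (val A <= val B)%VS.
Proof.
move=> /eqP dimA borelB; split=> [adjAB sAB | /negP nAB].
  by have /negP := nadj_sub_borel borelB sAB (subvv _).
by apply: borel_adj => //; apply: contraNneq nAB => ->.
Qed.

Lemma lines_adj A1 A2 : is_line A1 -> is_line A2 -> A1 != A2 ->
  adj A1 A2 <->
  ~ exists B : G, [/\ is_borel B, (val A1 <= val B)%VS & (val A2 <= val B)%VS].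
Proof.
move=> /eqP dimA1 /eqP dimA2 neA; split=> [adjA [B [borelB sA1 sA2]] | noB].
  by have /negP := nadj_sub_borel borelB sA1 sA2.
have nA12 : ~~ (val A1 <= val A2)%VS.
  by apply: contra neA => sA; rewrite -val_eqE eqEdim sA dimA1 dimA2.
(* By contraposition: if the lines do not generate everything, the subalgebra they generate has
   dimension exactly 2 and is itself the required Borel subalgebra. *)
rewrite /= /comaximal_adj neA /=; apply/negPn/negP => ngen; apply: noB.
have sgen := sub_lie_gen (val A1 + val A2)%VS.
have dim_gen : \dim (lie_gen (val A1 + val A2)) = 2%N.
  apply/eqP; rewrite eqn_leq; apply/andP; split.
    by rewrite leqNgt; apply: contra ngen => /full_sl2 /eqP.
  by apply: leq_trans (dimvS sgen); have := dim_addv_gt nA12; rewrite dimA2.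
have vgen : proper_subalgebra (lie_gen (val A1 + val A2)).
  by rewrite proper_subalgebra12 ?lie_gen_subalgebra // dim_gen.
by exists (Sub _ vgen : G); rewrite /is_borel SubK dim_gen eqxx;
   split=> //; apply: subv_trans sgen; rewrite ?addvSl ?addvSr.
Qed.

End Comaximality.

(** * Coordinates on [sl F 2] and the Borel subalgebras attached to points of the projective line *)

Section BorelParametrization.
Variable F : fieldType.
Notation L := (sl F 2).
Notation G := (comaximal_graph L).
Implicit Types (x y u v w : L) (U : {vspace L}) (o : option F).

Definition sl2a x : F := (vsval x : 'M_2) 0 0.
Definition sl2b x : F := (vsval x : 'M_2) 0 1.
Definition sl2c x : F := (vsval x : 'M_2) 1 0.

Lemma sl2d x : (vsval x : 'M_2) 1 1 = - sl2a x.
Proof.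
have := valP x; rewrite tracelessE /mxtrace !big_ord_recl big_ord0 addr0.
(* The expanded sum indexes its second term by a lifted ordinal, which agrees with [1] only after
   applying [val]. *)
rewrite addrC addr_eq0 => /eqP <-; by congr (vsval x _ _); apply: val_inj.
Qed.

Lemma sl2P x y :
  sl2a x = sl2a y -> sl2b x = sl2b y -> sl2c x = sl2c y -> x = y.
Proof.
move=> eqa eqb eqc; apply/val_inj/matrixP => i j.
have ord2 (k : 'I_2) : k = 0 \/ k = 1.
  by case: k => [[|[|//]] ltk]; [left | right]; apply: val_inj.
by case: (ord2 i) => ->; case: (ord2 j) => -> //=; rewrite !sl2d eqa.
Qed.

Fact sl2_coord_traceless (a b c : F) :
  (\matrix_(i < 2, j < 2) if i == j then if i == 0 then a else - a
                          else if i == 0 then b else c) \in traceless F 2.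
Proof. by rewrite tracelessE /mxtrace !big_ord_recl big_ord0 !mxE /= addr0 subrr. Qed.

Definition sl2_of (a b c : F) : L := Subvs (sl2_coord_traceless a b c).

Lemma sl2_ofK (a b c : F) :
  (sl2a (sl2_of a b c) = a) * (sl2b (sl2_of a b c) = b) *
  (sl2c (sl2_of a b c) = c).
Proof. by rewrite /sl2a /sl2b /sl2c /= !mxE. Qed.

Lemma sl20 : (sl2a 0 = 0) * (sl2b 0 = 0) * (sl2c 0 = 0).
Proof. by rewrite /sl2a /sl2b /sl2c linear0 !mxE. Qed.

Lemma sl2_lin (k : F) x y :
  (sl2a (k *: x + y) = k * sl2a x + sl2a y) *
  (sl2b (k *: x + y) = k * sl2b x + sl2b y) *
  (sl2c (k *: x + y) = k * sl2c x + sl2c y).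
Proof. by rewrite /sl2a /sl2b /sl2c linearP !mxE. Qed.

Lemma sl2_lieE x y :
  (sl2a (lie x y) = sl2b x * sl2c y - sl2b y * sl2c x) *
  (sl2b (lie x y) = 2%:R * (sl2a x * sl2b y - sl2a y * sl2b x)) *
  (sl2c (lie x y) = 2%:R * (sl2c x * sl2a y - sl2c y * sl2a x)).
Proof.
have mul2 (M N : 'M[F]_2) i j : (M *m N) i j = M i 0 * N 0 j + M i 1 * N 1 j.
  rewrite mxE !big_ord_recl big_ord0 addr0.
  by congr (_ + M _ _ * N _ _); apply: val_inj.
have lieM i j : (vsval (lie x y) : 'M_2) i j =
    (vsval x *m vsval y) i j - (vsval y *m vsval x) i j by rewrite !mxE.
(* The selected occurrences are the coordinates of [lie x y]; those of [x] and [y] stay folded for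
   [ring]. *)
rewrite {1}/sl2a {3}/sl2b {3}/sl2c.
rewrite !lieM !mul2 !sl2d -/(sl2a x) -/(sl2a y).
by rewrite -/(sl2b x) -/(sl2b y) -/(sl2c x) -/(sl2c y); do !split; ring.
Qed.

(* [Some t] is the point (1 : t) of the projective line, [None] is (0 : 1). *)
Definition borel_form o x : F^o :=
  if o is Some t then sl2c x - 2%:R * t * sl2a x - t ^+ 2 * sl2b x else sl2b x.

Fact borel_form_linear o : linear (borel_form o).
Proof.
move=> k x y; case: o => [t|]; rewrite /borel_form !sl2_lin // /GRing.scale /=.
ring.
Qed.

HB.instance Definition _ o :=
  GRing.isLinear.Build F L F^o _ (borel_form o) (borel_form_linear o).

Definition borel_space o : {vspace L} := lker (linfun (borel_form o)).

Lemma borel_spaceE o x : (x \in borel_space o) = (borel_form o x == 0).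
Proof. by rewrite memv_ker lfunE. Qed.

Lemma borel_space_subalgebra o : lie_subalgebra (borel_space o).
Proof.
apply/lie_subalgebraP => x y; rewrite !borel_spaceE.
case: o => [t|] /=; rewrite !sl2_lieE; last first.
  by move=> /eqP -> /eqP ->; rewrite !mulr0 subrr mulr0.
(* Each membership is put in the form c = 2ta + t^2 b, which eliminates c for both [x] and [y]. *)
rewrite -!addrA -!opprD !subr_eq0 => /eqP -> /eqP ->.
by apply/eqP; ring.
Qed.

Lemma dim_borel_space o : \dim (borel_space o) = 2%N.
Proof.
apply/eqP; rewrite eqn_leq; apply/andP; split.
  rewrite leqNgt; apply/negP => /full_sl2 eqL.
  (* On this matrix [borel_form o] takes the value 1 for either shape of [o], so the kernel is not
     everything. *)
  have := memvf (sl2_of 0 (o == None)%:R (o != None)%:R); rewrite -eqL.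
  rewrite borel_spaceE; case: (o) => [t|] /=; rewrite !sl2_ofK ?oner_eq0 //.
  by rewrite !mulr0 !subr0 oner_eq0.
have := limg_ker_dim (linfun (borel_form o)) fullv; rewrite capfv dim_sl2.
have : (\dim (limg (linfun (borel_form o))) <= 1)%N.
  by rewrite (leq_trans (dimvS (subvf _))) ?dimvf.
rewrite -/(borel_space o) => le1 eq3.
by rewrite -(leq_add2r 1) addn1 -[3%N]eq3 leq_add2l.
Qed.

Fact borel_space_proper o : proper_subalgebra (borel_space o).
Proof.
by rewrite proper_subalgebra12 ?borel_space_subalgebra // dim_borel_space.
Qed.

Definition borel o : G := Sub (borel_space o) (borel_space_proper o).

Lemma is_borel_borel o : is_borel (borel o).
Proof. by rewrite /is_borel SubK dim_borel_space. Qed.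

(** * When 2 is invertible, every Borel subalgebra comes from exactly one point *)

Hypothesis char_neq2 : 2%:R != 0 :> F.

Lemma borel_space_inj : injective borel_space.
Proof.
have neq_None t : borel_space (Some t) <> borel_space None.
  move=> /vspaceP /(_ (sl2_of 0 1 (t ^+ 2))).
  by rewrite !borel_spaceE /= !sl2_ofK mulr0 mulr1 subr0 subrr eqxx oner_eq0.
move=> [t|] [s|] // eqts; last 2 first.
- by case: (neq_None t).
- by case: (neq_None s).
(* This matrix has (1, t) as an eigenvector; having (1, s) as one too means 2t = 2s. *)
congr Some; apply/esym/eqP; have /vspaceP /(_ (sl2_of 1 0 (2%:R * t))) := eqts.
rewrite !borel_spaceE /= !sl2_ofK !mulr0 !mulr1 !subr0 subrr eqxx.
move/esym; rewrite -mulrBr mulf_eq0 (negPf char_neq2) subr_eq0 eq_sym.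
exact: id.
Qed.

(* In coordinates [lie u v] is, up to factors 2, the cross product. *)
Lemma sl2_commuting u v : u != 0 -> lie u v = 0 -> v \in <[u]>%VS.
Proof.
move=> nzu uv0.
have := congr1 sl2c uv0; have := congr1 sl2b uv0; have := congr1 sl2a uv0.
rewrite !sl2_lieE !sl20 => /eqP; rewrite subr_eq0 => /eqP eqa.
move=> /eqP; rewrite mulf_eq0 (negPf char_neq2) /= subr_eq0 => /eqP eqb.
move=> /eqP; rewrite mulf_eq0 (negPf char_neq2) /= subr_eq0 => /eqP eqc.
have prop (k : F) : sl2a v = k * sl2a u -> sl2b v = k * sl2b u ->
    sl2c v = k * sl2c u -> v \in <[u]>%VS.
  move=> ea eb ec; apply/vlineP; exists k.
  by apply: sl2P; rewrite -[k *: u]addr0 !sl2_lin !sl20 addr0.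
have cross (d p r s : F) : d != 0 -> p * d = r * s -> p = r / d * s.
  by move=> nzd eq_prod; rewrite mulrAC -eq_prod mulfK.
(* The ratio of [v] to [u] is read off at the first nonzero coordinate of [u]; the vanishing minors
   force it on the others. *)
have [a0|nza] := eqVneq (sl2a u) 0; last first.
  by apply: (prop (sl2a v / sl2a u)); apply: cross; rewrite // -?eqb -?eqc mulrC.
have [b0|nzb] := eqVneq (sl2b u) 0; last first.
  by apply: (prop (sl2b v / sl2b u)); apply: cross; rewrite // -?eqb -?eqa mulrC.
have [c0|nzc] := eqVneq (sl2c u) 0.
  by case/eqP: nzu; apply: sl2P; rewrite !sl20.
by apply: (prop (sl2c v / sl2c u)); apply: cross; rewrite // -?eqc -?eqa mulrC.
Qed.

(* The trace of the product matrix. *)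
Definition sl2_trace_form x y : F :=
  2%:R * sl2a x * sl2a y + sl2b x * sl2c y + sl2c x * sl2b y.

(** Isotropy says det w = 0, and [o] is the kernel of [w]: the row (a, b) kills (1, -a/b) if b is
    nonzero; otherwise a = 0 too and the kernel is spanned by (0, 1). *)
Lemma borel_of_isotropic w : w != 0 -> sl2_trace_form w w = 0 ->
  exists o, forall x, sl2_trace_form w x = 0 -> x \in borel_space o.
Proof.
move=> nzw; rewrite /sl2_trace_form => ww0.
have {}ww0 : sl2a w ^+ 2 = - (sl2b w * sl2c w).
  apply/eqP; rewrite -addr_eq0 -(inj_eq (mulfI char_neq2)) mulr0 -ww0.
  by apply/eqP; ring.
have [b0|nzb] := eqVneq (sl2b w) 0.
  have /eqP a0 : sl2a w == 0 by rewrite -sqrf_eq0 ww0 b0 mul0r oppr0.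
  have nzc : sl2c w != 0.
    apply: contraNneq nzw => c0; apply/eqP; apply: sl2P;
    by rewrite sl20.
  exists None => x; rewrite a0 b0 mulr0 !mul0r !add0r => /eqP.
  by rewrite mulf_eq0 (negPf nzc) borel_spaceE.
exists (Some (- sl2a w / sl2b w)) => x wx0; rewrite borel_spaceE /=.
(* Since a^2 = -bc for [w], multiplying the Borel form of [x] by b gives exactly the trace form of
   [w] and [x]. *)
rewrite -(inj_eq (mulfI nzb)) mulr0 -wx0 exprMn sqrrN ww0.
by apply/eqP; field.
Qed.

Lemma borel_space_surj U : lie_subalgebra U -> \dim U = 2%N ->
  exists o, borel_space o = U.
Proof.
move=> /lie_subalgebraP algU dimU.
have nzU : U != 0%VS by rewrite -dimv_eq0 dimU.
have nzu : vpick U != 0 by rewrite vpick0.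
have Uu := memv_pick U; move: (vpick U) nzu Uu => u nzu Uu.
have /subvPn [v Uv nuv] : ~~ (U <= <[u]>)%VS.
  by apply/negP => /dimvS; rewrite dimU dim_vline nzu.
have eqU : (<[u]> + <[v]>)%VS = U.
  apply/eqP; rewrite eqEdim subv_add -!memvE Uu Uv dimU addvC.
  have : ~~ (<[v]> <= <[u]>)%VS by rewrite -memvE.
  by move=> /dim_addv_gt; rewrite dim_vline nzu.
have nzw : lie u v != 0 by apply: contra nuv => /eqP /(sl2_commuting nzu).
have orthw x : x \in U -> sl2_trace_form (lie u v) x = 0.
  rewrite -eqU => /memv_addP[_ /vlineP[k ->] [_ /vlineP[l ->] ->]].
  rewrite -[l *: v]addr0 /sl2_trace_form !sl2_lin !sl2_lieE.
  by rewrite !sl20; ring.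
(* The bracket lies in [U] and is orthogonal to [U], hence to itself. *)
have [o oP] := borel_of_isotropic nzw (orthw _ (algU _ _ Uu Uv)).
exists o; apply/esym/eqP; rewrite eqEdim dim_borel_space dimU leqnn andbT.
by apply/subvP => x /orthw /oP.
Qed.

End BorelParametrization.

(** * Counting over a finite field of odd order *)

Lemma odd_card_neq2 (F : finFieldType) : odd #|F| -> 2%:R != 0 :> F.
Proof.
apply: contraL => /eqP two0.
(* If 2 = 0, then 1 has order 2 in the additive group, and Lagrange makes the order of the field
   even. *)
have order1 : #[1%R : F]%g = 2%N.
  by apply: nt_prime_order; rewrite // ?zmodXgE ?oner_eq0.
by rewrite -dvdn2 -order1 -cardsT order_dvdG ?inE.
Qed.

(** The projective line, encoded as [option F], has q + 1 points, and enumerating it enumerates the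
    Borel subalgebras. As distinct ones are always adjacent, any bijection of vertices is an
    isomorphism. *)
Lemma induced_borel_complete (F : finFieldType) : odd #|F| ->
  graph_isomorphic (induced (@is_borel F)) (complete_graph #|F|.+1).
Proof.
move=> /odd_card_neq2 char_neq2; rewrite -card_option.
pose h (i : complete_graph #|{: option F}|) : induced (@is_borel F) :=
  Sub (borel (enum_val i)) (is_borel_borel _).
have h_inj : injective h.
  move=> i j /(congr1 val) /(congr1 val) /= /(borel_space_inj char_neq2).
  exact: enum_val_inj.
have h_surj B : exists i, h i == B.
  have /and3P[algB _ _] := valP (val B).
  have [o eqB] := borel_space_surj char_neq2 algB (eqP (valP B)).
  (* Two layers to strip: an induced vertex wraps a comaximal vertex, which wraps a subspace. *)
  exists (enum_rank o); apply/eqP; apply: val_inj; apply: val_inj => /=.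
  by rewrite enum_rankK.
pose f B := xchoose (h_surj B).
have fK : cancel f h by move=> B; apply/eqP; apply: xchooseP (h_surj B).
have hK : cancel h f by move=> i; apply: h_inj.
exists f; first by exists h.
move=> A B; rewrite /= /complete_adj (can_eq fK) -val_eqE.
apply/idP/idP => [neAB|/andP[]//].
exact: borels_adj (valP A) (valP B) neAB.
Qed.

Theorem proposition4p11 (F : finFieldType) (odd_q : odd #|F|) :
  let G := comaximal_graph (sl F 2) in
  [/\ (forall A B : G, is_borel A -> is_borel B -> A != B -> adj A B) /\
        graph_isomorphic (induced (@is_borel F)) (complete_graph #|F|.+1),
      forall A B : G, is_line A -> is_borel B ->
        (adj A B <-> ~ (val A <= val B)%VS)
    & forall A1 A2 : G, is_line A1 -> is_line A2 -> A1 != A2 ->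
        (adj A1 A2 <->
         ~ exists B : G,
             [/\ is_borel B, (val A1 <= val B)%VS & (val A2 <= val B)%VS])].
Proof.
split; [split | exact: line_borel_adj | exact: lines_adj].
- exact: borels_adj.
- exact: induced_borel_complete.
Qed.
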